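(* Let $X\subseteq\mathbb{R}^n$ be nonempty, closed, convex and bounded, and let $F:X\to\mathbb{R}^n$ be monotone on $X$ (i.e. $\langle F(x)-F(y),x-y\rangle\ge 0$ for all $x,y\in X$) and satisfy, for some $\nu\in[0,\infty)$, $L_\nu>0$, $M_\nu\ge 0$, the growth condition $\|F(x)-F(y)\|_*\le L_\nu\|x-y\|^\nu+M_\nu$ for all $x,y\in X$. Let the samples satisfy the unbiasedness and bounded-variance conditions (with variance bound $\sigma^2$) stated in the context. Let the number of iterations $T\ge 0$ be given, let $c>0$, and let $D>0$ satisfy $\max_{x,z\in X}B_\psi(z,x)\le D$. Set $$\widehat D=\begin{cases}\dfrac{2^{2+\nu}L_\nu^2D^\nu}{\alpha^{1+\nu}}+\dfrac{17\sigma^2+16M_\nu^2}{2\alpha}&\text{if }\nu>0,\\[2mm]\dfrac{9\sigma^2+2(L_0+M_0)^2}{2\alpha}&\text{if }\nu=0.\end{cases}$$ Then the iterates of the stochastic Popov mirror-prox algorithm satisfy: (1) if $\gamma_t=\gamma=\frac{c}{\sqrt{T+1}}$ for all $t=0,\dots,T$, then $$\mathsf{E}\left[G\left(\frac{1}{T+1}\sum_{t=0}^Ty_{t+1}\right)\right]\le\frac{2D+c^2\widehat D}{c\sqrt{T+1}};$$ (2) if $\gamma_t=\frac{c}{\sqrt{t+1}}$ for $t=0,\dots,T$, then $$\mathsf{E}\left[G\left(\frac{\sum_{t=\lceil T/2\rceil}^T\gamma_ty_{t+1}}{\sum_{t=\lceil T/2\rceil}^T\gamma_t}\right)\right]\le\frac{4D+2\widehat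 D\,c^2\ln 4}{c\sqrt{T+1}}.$$
   Context: $\|\cdot\|$ is an arbitrary norm on $\mathbb{R}^n$, $\langle\cdot,\cdot\rangle$ the standard inner product, and $\|x\|_*=\max_{\|z\|\le1}\langle x,z\rangle$ the conjugate norm. For $\nu=0$ the term $\|x-y\|^0$ is read as $1$, and $L_0,M_0$ denote $L_\nu,M_\nu$ at $\nu=0$. The function $\psi:X\to\mathbb{R}$ is continuously differentiable and $\alpha$-strongly convex for some $\alpha>0$: $\psi(z)\ge\psi(x)+\langle\nabla\psi(x),z-x\rangle+\frac{\alpha}{2}\|z-x\|^2$ for all $x,z\in X$. Its Bregman divergence is $B_\psi(z,x)=\psi(z)-\psi(x)-\langle\nabla\psi(x),z-x\rangle$, $x,z\in X$. $F(x)=\mathsf{E}[\widehat F(x,\xi)]$ for all $x\in X$, where $\xi$ is a random variable with values in a set $\Omega$. Stochastic Popov mirror-prox algorithm: $x_0\in X$ is random with $\mathsf{E}[\|x_0\|^2]<\infty$, $y_0=x_0$, and for $t\ge0$ with step size $\gamma_t>0$, $$y_{t+1}=\operatorname*{argmin}_{z\in X}\left[\langle\gamma_t\widehat F(y_t,\xi_t)-\nabla\psi(x_t),z\rangle+\psi(z)\right],$$ $$x_{t+1}=\operatorname*{argmin}_{z\in X}\left[\langle\gamma_t\widehat F(y_{t+1},\xi_{t+1})-\nabla\psi(x_t),z\rangle+\psi(z)\right],$$ where $\xi_t\in\Omega$ is the random sample drawn at the iterate $y_t$. Information: $\mathcal{F}_{-1}=\{x_0\}$ and $\mathcal{F}_t=\{x_0\}\cup\{\xi_\tau\}_{\tau=0}^t$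 for $t\ge0$ (conditioning is on the generated $\sigma$-algebras). Sampling conditions: for all $z\in X$ and $t\ge0$, $\mathsf{E}[\widehat F(z,\xi_t)\mid\mathcal{F}_{t-1}]=F(z)$ and $\mathsf{E}[\|\widehat F(z,\xi_t)-F(z)\|_*^2\mid\mathcal{F}_{t-1}]\le\sigma^2$; these are understood to apply also at the $\mathcal{F}_{t-1}$-measurable point $z=y_t$ at which $\xi_t$ is drawn. Dual gap function: $G(x)=\sup_{z\in X}\langle F(z),x-z\rangle$ for $x\in X$. *)

(* Defs.v *)
From HB Require Import structures.
From mathcomp Require Import all_boot all_order all_algebra.
From mathcomp Require Import all_classical all_reals all_analysis.

Set Implicit Arguments.
Unset Strict Implicit.
Unset Printing Implicit Defensive.

Import Order.TTheory GRing.Theory Num.Theory.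
Import numFieldNormedType.Exports.

Local Open Scope classical_set_scope.
Local Open Scope ring_scope.

Definition dot {R : realType} {n : nat} (u v : 'rV[R]_n) : R :=
  \sum_(i < n) u 0 i * v 0 i.

(* An arbitrary norm on R^n, distinct in general from the library's [`|v|],
   which is the max norm and only serves to provide the topology. *)
Record is_norm {R : realType} {n : nat} (nrm : 'rV[R]_n -> R) : Prop := IsNorm {
  is_norm_eq0 : forall v, nrm v = 0 -> v = 0 ;
  is_normZ : forall a v, nrm (a *: v) = `|a| * nrm v ;
  is_normD : forall u v, nrm (u + v) <= nrm u + nrm v }.

(* The set below is bounded and contains 0 when [nrm] is a norm, so that [sup]
   is the maximum. *)
Definition dual_norm {R : realType} {n : nat} (nrm : 'rV[R]_n -> R)
    (x : 'rV[R]_n) : R :=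
  sup [set dot x z | z in [set z | nrm z <= 1]].

Section convex_analysis.
Context {R : realType} {n : nat}.
Implicit Types (X : set 'rV[R]_n) (F : 'rV[R]_n -> 'rV[R]_n).
Implicit Types (nrm psi : 'rV[R]_n -> R) (gpsi : 'rV[R]_n -> 'rV[R]_n).

Definition monotone_on X F : Prop :=
  forall x y, X x -> X y -> 0 <= dot (F x - F y) (x - y).

(* [0 `^ 0 = 1], so that for nu = 0 the bound is L + M, also at x = y. *)
Definition growth_on X nrm F (nu L M : R) : Prop :=
  forall x y, X x -> X y ->
    dual_norm nrm (F x - F y) <= L * nrm (x - y) `^ nu + M.

(* psi is only given on X, which may have an empty interior: its gradient is a
   continuous map gpsi on X providing the first-order expansion of psi at each
   point of X along X. *)
Definition C1_on X psi gpsi : Prop :=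
  {within X, continuous gpsi} /\
  forall x, X x -> let near_x := within X (nbhs x) in
    (fun z => psi z - psi x - dot (gpsi x) (z - x) : R^o) =o_near_x (fun z => z - x).

Definition strongly_convex_on X nrm psi gpsi (alpha : R) : Prop :=
  forall x z, X x -> X z ->
    psi x + dot (gpsi x) (z - x) + alpha / 2 * nrm (z - x) ^+ 2 <= psi z.

Definition bregman psi gpsi (z x : 'rV[R]_n) : R :=
  psi z - psi x - dot (gpsi x) (z - x).

Definition is_argmin X (f : 'rV[R]_n -> R) (p : 'rV[R]_n) : Prop :=
  X p /\ forall z, X z -> f p <= f z.

(* The supremum is finite when X and F X are bounded; taking it in [\bar R]
   avoids the default value of [sup] on unbounded sets. *)
Definition dual_gap X F (x : 'rV[R]_n) : \bar R :=
  ereal_sup [set (dot (F z) (x - z))%:E | z in X].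

End convex_analysis.

Section stochastic.
Context {R : realType} {n : nat}.
Context {d : measure_display} {W : measurableType d} (P : probability W R).
Context {d' : measure_display} {Om : measurableType d'}.
Implicit Types (X : set 'rV[R]_n) (F : 'rV[R]_n -> 'rV[R]_n).
Implicit Types (Fhat : 'rV[R]_n -> Om -> 'rV[R]_n) (p : W -> 'rV[R]_n).

Definition random_vector p : Prop :=
  forall i, measurable_fun [set: W] (fun w => p w 0 i).

(* Joint measurability of Fhat on X x Om, R^n carrying the product
   sigma-algebra of [n.-tuple R]. It makes Fhat (y_t, xi_t) a random vector. *)
Definition jointly_measurable X Fhat : Prop :=
  forall i, measurable_fun
    [set q : n.-tuple R * Om | X (\row_j tnth q.1 j)]
    (fun q : n.-tuple R * Om => Fhat (\row_j tnth q.1 j) q.2 0 i).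

Definition mean_operator X Fhat F (xi : W -> Om) : Prop :=
  forall x, X x -> forall i,
    P.-integrable [set: W] (EFin \o (fun w => Fhat x (xi w) 0 i)) /\
    ('E_P[(fun w => Fhat x (xi w) 0 i)%R] = (F x 0 i)%:E)%E.

(* Z is a version of E[Y | sigma(gens)]. *)
Definition cond_expectation (gens : set (set W)) (Y Z : W -> R) : Prop :=
  [/\ P.-integrable [set: W] (EFin \o Y),
      P.-integrable [set: W] (EFin \o Z),
      measurable_fun [set: g_sigma_algebraType gens] Z &
      forall A, <<s gens >> A ->
        (\int[P]_(w in A) (Y w)%:E = \int[P]_(w in A) (Z w)%:E)%E].

(* sigma(history x0 xi t) is generated by x0, xi_0, ..., xi_(t-1): it is the
   sigma-algebra written F_(t-1), whose index is shifted here to start at 0. *)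
Definition history (x0 : W -> 'rV[R]_n) (xi : nat -> W -> Om) (t : nat) :
    set (set W) :=
  (\bigcup_(i in [set: 'I_n])
      preimage_set_system [set: W] (fun w => x0 w 0 i) measurable) `|`
  (\bigcup_(s in [set s | (s < t)%N])
      preimage_set_system [set: W] (xi s) measurable).

(* Unbiasedness (coordinatewise) and variance bound, given sigma(gens), for a
   sample s drawn at the possibly random point p. *)
Definition sampling_at nrm F Fhat (sigma : R) (gens : set (set W)) p
    (s : W -> Om) : Prop :=
  (forall i, cond_expectation gens
     (fun w => Fhat (p w) (s w) 0 i) (fun w => F (p w) 0 i)) /\
  exists V : W -> R,
    cond_expectation gens
      (fun w => dual_norm nrm (Fhat (p w) (s w) - F (p w)) ^+ 2) V /\
    {ae P, forall w, V w <= sigma ^+ 2}.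

Record popov_iterates X psi gpsi Fhat (xi : nat -> W -> Om) (gam : nat -> R)
    (x y : nat -> W -> 'rV[R]_n) : Prop := PopovIterates {
  popov_x0 : forall w, X (x 0 w) ;
  popov_y0 : forall w, y 0 w = x 0 w ;
  popov_y : forall t w, is_argmin X
    (fun z => dot (gam t *: Fhat (y t w) (xi t w) - gpsi (x t w)) z + psi z)
    (y t.+1 w) ;
  popov_x : forall t w, is_argmin X
    (fun z => dot (gam t *: Fhat (y t.+1 w) (xi t.+1 w) - gpsi (x t w)) z
              + psi z)
    (x t.+1 w) }.

End stochastic.

Definition Dhat {R : realType} (nu L M alpha D sigma : R) : R :=
  if 0 < nu then
    2 `^ (2 + nu) * L ^+ 2 * D `^ nu / alpha `^ (1 + nu)
    + (17 * sigma ^+ 2 + 16 * M ^+ 2) / (2 * alpha)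
  else (9 * sigma ^+ 2 + 2 * (L + M) ^+ 2) / (2 * alpha).

(* Main.v *)
Require Import Defs.
From HB Require Import structures.
From mathcomp Require Import all_boot all_order all_algebra.
From mathcomp Require Import all_classical all_reals all_analysis.
From mathcomp Require Import measurable_realfun zify ring lra.

Set Implicit Arguments.
Unset Strict Implicit.
Unset Printing Implicit Defensive.

Import Order.TTheory GRing.Theory Num.Theory.
Import numFieldNormedType.Exports.

Local Open Scope classical_set_scope.
Local Open Scope ring_scope.

(* Write e_t = Fhat(y_t, xi_t) - F(y_t) for the noise. The optimality
   conditions of the two argmin steps and Young's inequality bound gamma_t
   <Fhat(y_{t+1}, xi_{t+1}), y_{t+1} - z> by B(z, x_t) - B(z, x_{t+1}) plus a
   multiple of gamma_t^2 |Fhat(y_{t+1}, xi_{t+1}) - Fhat(y_t, xi_t)|_*^2, and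
   the variation of F is bounded on X by a constant K. Passing to F(z) by
   monotonicity leaves - gamma_t <e_{t+1}, y_{t+1} - z>, whose supremum over z
   is not a martingale difference. It is split at u_t, the mirror descent
   iterates driven by the noise itself: their regret costs another Bregman
   telescope, which doubles D, and <e_{t+1}, y_{t+1} - u_t> has mean zero
   because y_{t+1} and u_t depend only on the past. *)

(** * Bilinearity of the inner product and its comparison with the max norm *)

Section dot.
Context {R : realType} {n : nat}.
Implicit Types (u v w : 'rV[R]_n) (a : R).

Lemma dotDl u v w : dot (u + v) w = dot u w + dot v w.
Proof. by rewrite -big_split; apply: eq_bigr => i _; rewrite mxE mulrDl. Qed.

Lemma dotDr u v w : dot u (v + w) = dot u v + dot u w.
Proof. by rewrite -big_split; apply: eq_bigr => i _; rewrite mxE mulrDr. Qed.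

Lemma dotZl a u v : dot (a *: u) v = a * dot u v.
Proof. by rewrite mulr_sumr; apply: eq_bigr => i _; rewrite mxE mulrA. Qed.

Lemma dotZr a u v : dot u (a *: v) = a * dot u v.
Proof. by rewrite mulr_sumr; apply: eq_bigr => i _; rewrite mxE mulrCA. Qed.

Lemma dotNl u v : dot (- u) v = - dot u v.
Proof. by rewrite -scaleN1r dotZl mulN1r. Qed.

Lemma dotNr u v : dot u (- v) = - dot u v.
Proof. by rewrite -scaleN1r dotZr mulN1r. Qed.

Definition dotE := (dotDl, dotDr, dotNl, dotNr, dotZl, dotZr).

Lemma dot0r v : dot v 0 = 0.
Proof. by rewrite /dot big1 // => i _; rewrite mxE mulr0. Qed.

Lemma dot_sumr u (I : Type) (r : seq I) (Q : pred I) (f : I -> 'rV[R]_n) :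
  dot u (\sum_(i <- r | Q i) f i) = \sum_(i <- r | Q i) dot u (f i).
Proof.
elim/big_rec2: _ => [|i a v _ <-]; last by rewrite dotDr.
exact: dot0r.
Qed.

Lemma coord_le_norm v i : `|v 0 i| <= `|v|.
Proof.
by rewrite [leRHS]/Num.norm /= mx_normrE; apply/bigmax_geP; right; exists (0, i).
Qed.

Lemma norm_lt_coord v a : 0 < a -> (`|v| < a) = [forall i, `|v 0 i| < a].
Proof.
move=> a0; apply/idP/forallP => [va i|va].
  exact: le_lt_trans (coord_le_norm _ _) va.
rewrite [ltLHS]/Num.norm /= mx_normrE; apply/bigmax_ltP; split=> // -[i j] _ /=.
by rewrite ord1.
Qed.

Lemma dot_norm_le u v : `|dot u v| <= (\sum_(i < n) `|u 0 i|) * `|v|.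
Proof.
rewrite mulr_suml; apply: le_trans (ler_norm_sum _ _ _) _.
by apply: ler_sum => i _; rewrite normrM ler_wpM2l// coord_le_norm.
Qed.

End dot.

(** * Equivalence of norms and the dual norm *)

Section norm_equivalence.
Context {R : realType} {n : nat} (nrm : 'rV[R]_n -> R) (hn : is_norm nrm).
Implicit Types u v : 'rV[R]_n.

Lemma is_norm0 : nrm 0 = 0.
Proof. by rewrite -(scale0r (0 : 'rV[R]_n)) (is_normZ hn) normr0 mul0r. Qed.

Lemma is_normN v : nrm (- v) = nrm v.
Proof. by rewrite -scaleN1r (is_normZ hn) normrN1 mul1r. Qed.

Lemma is_norm_ge0 v : 0 <= nrm v.
Proof.
have := is_normD hn v (- v); rewrite subrr is_norm0 is_normN -mulr2n.
by rewrite pmulrn_lge0.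
Qed.

Lemma is_norm_le_norm : exists2 C, 0 <= C & forall v, nrm v <= C * `|v|.
Proof.
exists (\sum_(i < n) nrm (delta_mx 0 i)) => [|v].
  by apply: sumr_ge0 => i _; exact: is_norm_ge0.
rewrite [v in leLHS]row_sum_delta mulr_suml.
elim/big_ind2: _ => [|a b c e ac be|i _]; first by rewrite is_norm0.
  by apply: le_trans (is_normD hn _ _) _; rewrite lerD.
by rewrite (is_normZ hn) mulrC ler_wpM2l ?is_norm_ge0// coord_le_norm.
Qed.

Lemma is_norm_continuous : continuous (nrm : 'rV[R]_n -> R^o).
Proof.
have [C C0 hC] := is_norm_le_norm => v.
apply/(@cvgrPdist_lt _ _ _ _ (nbhs_filter v)) => e e0.
near=> u.
have uv : `|v - u| < e / (C + 1).
  near: u; apply/nbhs_ballP; exists (e / (C + 1)) => /= [|u].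
    by rewrite divr_gt0 ?ltr_wpDl.
  by rewrite mx_norm_ball.
suff : `|nrm v - nrm u| <= nrm (v - u).
  move/le_lt_trans; apply; apply: le_lt_trans (hC _) _.
  rewrite ltr_pdivlMr ?ltr_wpDl// in uv; apply: le_lt_trans uv.
  by rewrite mulrC ler_wpM2l// lerDl.
have := is_normD hn (v - u) u; have := is_normD hn (u - v) v.
rewrite !subrK -[u - v]opprB is_normN => h1 h2.
by rewrite ler_norml; apply/andP; split; lra.
Unshelve. all: by end_near. Qed.

(** The constant is the minimum of the continuous function [nrm] on the compact unit sphere of the
    max norm, positive because [nrm] vanishes only at 0. *)
Lemma norm_le_is_norm : exists2 k, 0 < k & forall v, k * `|v| <= nrm v.
Proof.
(* The sphere is empty when n = 0; every vector is then 0 and any constant works. *)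
have [S0|S0] := pselect ([set v : 'rV[R]_n | `|v| = 1] !=set0); last first.
  exists 1 => // v; have [->|v0] := eqVneq v 0.
    by rewrite normr0 mulr0 is_norm_ge0.
  case: S0; exists (`|v|^-1 *: v) => /=.
  by rewrite normrZ normfV normr_id mulVf// normr_eq0.
have Sc : compact [set v : 'rV[R]_n | `|v| = 1].
  apply: bounded_closed_compact.
    by exists 1; split => // r r1 v /= ->; exact: ltW.
  have cN : {in ~` ((Num.norm : 'rV[R]_n -> R) @^-1` [set 1]),
      continuous (Num.norm : 'rV[R]_n -> R)}.
    by move=> v _; exact: norm_continuous.
  exact: (preimage_closed cN (@closed_eq _ _)).
have cf : {within [set v : 'rV[R]_n | `|v| = 1], continuous nrm}.
  by apply: continuous_subspaceT => ?; exact: is_norm_continuous.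
have [c /set_mem /= c1 cmin] := EVT_min_rV S0 Sc cf.
exists (nrm c).
  rewrite lt_neqAle is_norm_ge0 andbT eq_sym; apply/eqP => /(is_norm_eq0 hn) c0.
  by move: c1; rewrite c0 normr0 => /eqP; rewrite eq_sym oner_eq0.
move=> v; have [->|v0] := eqVneq v 0; first by rewrite normr0 mulr0 is_norm_ge0.
have /mem_set/cmin : [set v : 'rV[R]_n | `|v| = 1] (`|v|^-1 *: v).
  by rewrite /= normrZ normfV normr_id mulVf// normr_eq0.
by rewrite (is_normZ hn) normfV normr_id ler_pdivlMl ?normr_gt0// mulrC.
Qed.

(** [sup] is meaningful only on a nonempty set bounded above; boundedness holds because the unit
    ball of [nrm] is bounded in the max norm. *)
Lemma dual_norm_has_sup u : has_sup [set dot u z | z in [set z | nrm z <= 1]].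
Proof.
split; first by exists (dot u 0); exists 0 => //=; rewrite is_norm0.
have [k k0 hk] := norm_le_is_norm.
exists ((\sum_(i < n) `|u 0 i|) * k^-1) => _ [z /= z1 <-].
apply: le_trans (ler_norm _) _; apply: le_trans (dot_norm_le _ _) _.
rewrite ler_wpM2l ?sumr_ge0// -[leRHS]mulr1 ler_pdivlMl//.
exact: le_trans (hk _) _.
Qed.

Lemma dual_norm_ge0 u : 0 <= dual_norm nrm u.
Proof.
apply: (sup_ubound (dual_norm_has_sup u).2).
by exists 0 => /=; rewrite ?is_norm0// dot0r.
Qed.

Lemma dot_le_dual_norm u v : dot u v <= dual_norm nrm u * nrm v.
Proof.
have [/eqP|v0] := eqVneq (nrm v) 0.
  move=> /eqP/(is_norm_eq0 hn) ->; rewrite is_norm0 mulr0.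
  by rewrite dot0r.
have v0' : 0 < nrm v by rewrite lt_neqAle eq_sym v0 is_norm_ge0.
rewrite -ler_pdivrMr// mulrC -dotZr.
apply: (sup_ubound (dual_norm_has_sup u).2); exists ((nrm v)^-1 *: v) => //=.
by rewrite (is_normZ hn) ger0_norm ?invr_ge0 ?is_norm_ge0// mulVf.
Qed.

Lemma dual_normD u v : dual_norm nrm (u + v) <= dual_norm nrm u + dual_norm nrm v.
Proof.
apply: ge_sup => [|_ [z /= z1 <-]]; first exact: (dual_norm_has_sup _).1.
rewrite dotDl lerD//; apply: (sup_ubound (dual_norm_has_sup _).2); by exists z.
Qed.

Lemma dual_normN u : dual_norm nrm (- u) = dual_norm nrm u.
Proof.
congr sup; apply/seteqP; split=> _ [z /= z1 <-]; exists (- z);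
  by rewrite /= ?is_normN ?dotE ?opprK.
Qed.

End norm_equivalence.

(** * Deterministic analysis of mirror steps *)

Section mirror_maps.
Context {R : realType} {n : nat} (nrm : 'rV[R]_n -> R) (hn : is_norm nrm).
Context (X : set 'rV[R]_n).
Hypothesis Xclosed : closed X.
Hypothesis Xconvex : convex_set (X : set (convex_lmodType 'rV[R]_n)).
Hypothesis Xbounded : bounded_set X.
Context (psi : 'rV[R]_n -> R) (gpsi : 'rV[R]_n -> 'rV[R]_n) (alpha : R).
Hypothesis psiC1 : C1_on X psi gpsi.
Hypothesis alpha0 : 0 < alpha.
Hypothesis psi_sc : strongly_convex_on X nrm psi gpsi alpha.
Implicit Types p q u v x y z g : 'rV[R]_n.

Lemma within_nbhs_norm x (Q : set 'rV[R]_n) : within X (nbhs x) Q ->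
  exists2 a : R, 0 < a & forall z, X z -> `|z - x| < a -> Q z.
Proof.
move=> /nbhs_ballP[a /= a0 aQ]; exists a => // z Xz zx; apply: aQ => //.
by rewrite mx_norm_ball /ball_ /= distrC.
Qed.

Lemma C1_on_expansion x (e : R) : X x -> 0 < e ->
  exists2 a : R, 0 < a & forall z, X z -> `|z - x| < a ->
    `|psi z - psi x - dot (gpsi x) (z - x)| <= e * `|z - x|.
Proof.
move=> Xx e0; apply: within_nbhs_norm.
by have /eqoP/(_ _ e0) := psiC1.2 x Xx.
Qed.

Lemma C1_on_gradient_continuous x (e : R) : X x -> 0 < e ->
  exists2 a : R, 0 < a & forall z, X z -> `|z - x| < a ->
    `|gpsi z - gpsi x| < e.
Proof.
move=> Xx e0; apply: within_nbhs_norm.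
have /subspace_continuousP/(_ x Xx)/cvgrPdist_lt/(_ e e0) := psiC1.1.
by apply: filterS => z; rewrite distrC.
Qed.

(** If the slope a at p towards z were negative, a short move along the segment from p to z, which
    stays in X by convexity, would decrease the objective. *)
Lemma argmin_first_order q p z : X z ->
  is_argmin X (fun z => dot q z + psi z) p -> 0 <= dot (q + gpsi p) (z - p).
Proof.
move=> Xz [Xp pmin]; rewrite leNgt; apply/negP => a0.
set h := z - p in a0 *; set a := dot _ _ in a0.
have h1 : 0 < `|h| + 1 by rewrite ltr_wpDl.
(* With this tolerance a + e |h| < 0, so the expansion error cannot cancel the slope; the + 1 avoids
   division by zero. *)
pose e := - a / (2 * (`|h| + 1)).
have e0 : 0 < e by rewrite divr_gt0 ?oppr_gt0 ?mulr_gt0.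
have [r r0 hr] := C1_on_expansion Xp e0.
pose t := Num.min 1 (r / (2 * (`|h| + 1))).
have t0 : 0 < t by rewrite lt_min ltr01 divr_gt0 ?mulr_gt0.
have t1 : t <= 1 by rewrite ge_min lexx.
have tr : t * `|h| < r.
  have : t * (2 * (`|h| + 1)) <= r.
    by rewrite -ler_pdivlMr ?mulr_gt0// ge_min lexx orbT.
  by apply: lt_le_trans; have := normr_ge0 h; nra.
have Xzt : X (p + t *: h).
  have /set_mem := Xconvex (Itv01 (ltW t0) t1) (mem_set Xz) (mem_set Xp).
  congr X; rewrite /conv/=.
  by rewrite /h scalerBr scalerBl scale1r addrCA addrA.
have := pmin _ Xzt; have := hr _ Xzt.
rewrite addrAC subrr add0r normrZ (gtr0_norm t0) => /(_ tr).
rewrite ler_norml dotZr dotDr dotZr => /andP[_ h2] h3.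
have ah : a = dot q h + dot (gpsi p) h by rewrite /a dotDl.
have : 0 <= t * (a + e * `|h|).
  by move: h2 h3; rewrite ah !mulrDr [t * (e * _)]mulrCA; lra.
rewrite pmulr_rge0// leNgt => /negP; apply.
have : e * (2 * (`|h| + 1)) = - a by rewrite /e divfK// gt_eqF// mulr_gt0.
by have := mulr_ge0 (ltW e0) (normr_ge0 h); lra.
Qed.

(** X is compact, and the objective is continuous on X because differentiability of [psi] implies
    its continuity. *)
Lemma exists_argmin q : X !=set0 ->
  exists p, is_argmin X (fun z => dot q z + psi z) p.
Proof.
move=> X0; have Xc := bounded_closed_compact Xbounded Xclosed.
have cf : {within X, continuous (fun z => dot q z + psi z)}.
  apply/subspace_continuousP => x Xx; apply/cvgrPdist_lt => e e0.
  have [a a0 ha] := C1_on_expansion Xx ltr01.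
  (* Near x the objective varies by at most (S + 1) |z - x|: S bounds the linear part and 1 the
     remainder of the expansion. *)
  pose S := \sum_(i < n) `|(q + gpsi x) 0 i|.
  have S1 : 0 < S + 1 by rewrite ltr_wpDl ?sumr_ge0.
  apply/nbhs_ballP; exists (Num.min a (e / (S + 1))) => /=.
    by rewrite lt_min a0 divr_gt0.
  move=> z; rewrite mx_norm_ball /ball_/= distrC lt_min => /andP[za ze] Xz.
  rewrite distrC; move: ze; rewrite ltr_pdivlMr// mulrDr mulr1; apply: le_lt_trans.
  rewrite (_ : _ - _ = dot (q + gpsi x) (z - x) +
                       (psi z - psi x - dot (gpsi x) (z - x))); last first.
    by rewrite !dotE /from_subspace; ring.
  apply: le_trans (ler_normD _ _) _; rewrite lerD//.
    by rewrite mulrC dot_norm_le.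
  by rewrite -[leRHS]mul1r ha.
have [p /set_mem Xp pmin] := EVT_min_rV X0 Xc cf.
by exists p; split=> // z Xz; apply: pmin; exact: mem_set.
Qed.

Lemma bregman_ge_norm x z : X x -> X z ->
  alpha / 2 * nrm (z - x) ^+ 2 <= bregman psi gpsi z x.
Proof. by move=> Xx Xz; have := psi_sc Xx Xz; rewrite /bregman; lra. Qed.

Lemma bregman_ge0 x z : X x -> X z -> 0 <= bregman psi gpsi z x.
Proof.
move=> Xx Xz; apply: le_trans (bregman_ge_norm Xx Xz).
by rewrite mulr_ge0 ?sqr_ge0// divr_ge0// ltW.
Qed.

(** The first-order condition at p combined with the three-point identity for Bregman
    divergences. *)
Lemma mirror_step g x p z : X z ->
  is_argmin X (fun z => dot (g - gpsi x) z + psi z) p ->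
  dot g (p - z) <=
    bregman psi gpsi z x - bregman psi gpsi z p - bregman psi gpsi p x.
Proof.
by move=> Xz /(argmin_first_order Xz); rewrite /bregman !dotE; lra.
Qed.

(** Adding the two optimality conditions and the two strong convexity inequalities gives alpha nrm
    (p - p')^2 <= <q' - q, p - p'>. This stability later yields both uniqueness and measurability of
    the iterates. *)
Lemma argmin_lipschitz : exists2 C : R, 0 < C &
  forall q q' p p',
    is_argmin X (fun z => dot q z + psi z) p ->
    is_argmin X (fun z => dot q' z + psi z) p' ->
  `|p - p'| <= C * `|q - q'|.
Proof.
have [k k0 hk] := norm_le_is_norm hn.
have ak : 0 < alpha * k ^+ 2 by rewrite mulr_gt0 ?exprn_gt0.
(* The dimension comes from bounding a sum of n coordinates by the max norm; [n.+1] keeps the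
   constant positive for n = 0. *)
exists (n.+1%:R / (alpha * k ^+ 2)) => [|q q' p p' hp hp'].
  by rewrite divr_gt0.
have [->|pp'] := eqVneq p p'.
  by rewrite subrr normr0 mulr_ge0// divr_ge0// ltW.
have {}pp' : 0 < `|p - p'| by rewrite normr_gt0 subr_eq0.
have [Xp Xp'] := (hp.1, hp'.1).
have h1 := argmin_first_order Xp' hp; have h2 := argmin_first_order Xp hp'.
have h3 := psi_sc Xp Xp'; have h4 := psi_sc Xp' Xp.
have h5 : alpha * nrm (p - p') ^+ 2 <= dot (q' - q) (p - p').
  have h6 : nrm (p' - p) = nrm (p - p') by rewrite -(is_normN hn) opprB.
  rewrite h6 in h3; move: h1 h2 h3 h4; rewrite !dotE; lra.
have h6 : alpha * (k * `|p - p'|) ^+ 2 <= n.+1%:R * `|q - q'| * `|p - p'|.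
  apply: (@le_trans _ _ (alpha * nrm (p - p') ^+ 2)).
    rewrite ler_wpM2l ?(ltW alpha0)// lerXn2r ?nnegrE ?is_norm_ge0//.
    by rewrite mulr_ge0// ltW.
  apply: le_trans h5 _; apply: le_trans (ler_norm _) _.
  apply: le_trans (dot_norm_le _ _) _; rewrite ler_wpM2r//.
  rewrite distrC; apply: (@le_trans _ _ (\sum_(i < n) `|q' - q|)).
    by apply: ler_sum => i _; exact: coord_le_norm.
  by rewrite sumr_const card_ord -[leLHS]mulr_natl ler_wpM2r// ler_nat.
rewrite mulrAC ler_pdivlMr// -(ler_pM2r pp'); apply: le_trans h6.
by rewrite exprMn expr2; lra.
Qed.

(** Expand (|c| |g|_* - alpha |v|)^2 >= 0 and use the duality bound on the inner product. *)
Lemma young_dual g v c :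
  c * dot g v - alpha / 2 * nrm v ^+ 2 <=
    c ^+ 2 / (2 * alpha) * dual_norm nrm g ^+ 2.
Proof.
have h : c * dot g v <= `|c| * dual_norm nrm g * nrm v.
  apply: le_trans (ler_norm _) _; rewrite normrM -mulrA ler_wpM2l//.
  rewrite ler_norml dot_le_dual_norm// andbT lerNl -dotNl.
  by rewrite -(dual_normN hn) dot_le_dual_norm.
have -> : c ^+ 2 = `|c| ^+ 2 by rewrite -normrX ger0_norm ?sqr_ge0.
rewrite [leRHS]mulrAC ler_pdivlMr ?mulr_gt0//.
have := sqr_ge0 (`|c| * dual_norm nrm g - alpha * nrm v).
move: (dual_norm nrm g) (nrm v) h => a b h.
have := ler_wpM2l (ltW alpha0) h; nra.
Qed.

(** The step to x1 is tested at z and the step to y1 at x1, so that B(x1, x) cancels. What remains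
    is gam <g1 - g0, y1 - x1>, which Young's inequality absorbs into B(x1, y1). *)
Lemma popov_step gam g0 g1 x y1 x1 z : X x -> X z ->
  is_argmin X (fun z => dot (gam *: g0 - gpsi x) z + psi z) y1 ->
  is_argmin X (fun z => dot (gam *: g1 - gpsi x) z + psi z) x1 ->
  gam * dot g1 (y1 - z) <= bregman psi gpsi z x - bregman psi gpsi z x1
    + gam ^+ 2 / (2 * alpha) * dual_norm nrm (g1 - g0) ^+ 2.
Proof.
move=> Xx Xz hy hx; have [Xy1 Xx1] := (hy.1, hx.1).
have h1 := mirror_step Xz hx; have h2 := mirror_step Xx1 hy.
have h3 := bregman_ge0 Xx Xy1; have h4 := bregman_ge_norm Xy1 Xx1.
have := young_dual (g1 - g0) (y1 - x1) gam.
rewrite -(is_normN hn) opprB; move: h1 h2; rewrite !dotE; lra.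
Qed.

(** Here the leftover is gam <e, u - u1>, absorbed into B(u1, u). *)
Lemma mirror_regret gam e u u1 z : X u -> X z ->
  is_argmin X (fun z => dot (gam *: e - gpsi u) z + psi z) u1 ->
  gam * dot e (u - z) <= bregman psi gpsi z u - bregman psi gpsi z u1
    + gam ^+ 2 / (2 * alpha) * dual_norm nrm e ^+ 2.
Proof.
move=> Xu Xz hu; have Xu1 := hu.1.
have h1 := mirror_step Xz hu; have h2 := bregman_ge_norm Xu Xu1.
have := young_dual e (u - u1) gam.
rewrite -(is_normN hn) opprB; move: h1; rewrite !dotE; lra.
Qed.

(** The auxiliary step from u to u1 is driven by minus the noise at y1. Its regret replaces the
    comparison point z by u in the noise term, leaving a last term independent of z. The factor 5 is
    4 from the bound on g1 - g0 plus 1 from this regret. *)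
Lemma gap_step (F : 'rV[R]_n -> 'rV[R]_n) K gam g0 g1 y0 x y1 x1 u u1 z :
  monotone_on X F -> dual_norm nrm (F y1 - F y0) <= K -> 0 <= gam ->
  X x -> X u -> X z ->
  is_argmin X (fun z => dot (gam *: g0 - gpsi x) z + psi z) y1 ->
  is_argmin X (fun z => dot (gam *: g1 - gpsi x) z + psi z) x1 ->
  is_argmin X (fun z => dot (gam *: (F y1 - g1) - gpsi u) z + psi z) u1 ->
  gam * dot (F z) (y1 - z) <=
    (bregman psi gpsi z x - bregman psi gpsi z x1)
    + (bregman psi gpsi z u - bregman psi gpsi z u1)
    + gam ^+ 2 * ((2 * K ^+ 2 + 5 * dual_norm nrm (g1 - F y1) ^+ 2
                   + 4 * dual_norm nrm (g0 - F y0) ^+ 2) / (2 * alpha))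
    - gam * dot (g1 - F y1) (y1 - u).
Proof.
move=> Fmono FK gam0 Xx Xu Xz hy hx hu.
have h1 := popov_step Xx Xz hy hx; have h2 := mirror_regret Xu Xz hu.
have h3 : 0 <= dot (F y1 - F z) (y1 - z) by apply: Fmono => //; exact: hy.1.
have {}h3 := mulr_ge0 gam0 h3.
(* For noise norms a and b, (a + K + b)^2 <= 2 K^2 + 2 (a + b)^2 <= 2 K^2 + 4 a^2 + 4 b^2. *)
have h4 : dual_norm nrm (g1 - g0) ^+ 2 <= 2 * K ^+ 2
    + 4 * dual_norm nrm (g1 - F y1) ^+ 2 + 4 * dual_norm nrm (g0 - F y0) ^+ 2.
  have h5 : dual_norm nrm (g1 - g0) <=
      dual_norm nrm (g1 - F y1) + K + dual_norm nrm (g0 - F y0).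
    rewrite (_ : g1 - g0 = (g1 - F y1) + (F y1 - F y0) - (g0 - F y0)); last first.
      by rewrite opprB !addrA !subrK.
    apply: le_trans (dual_normD hn _ _) _; rewrite (dual_normN hn) lerD2r.
    by apply: le_trans (dual_normD hn _ _) _; rewrite lerD2l.
  have := dual_norm_ge0 hn (g1 - g0).
  move: (dual_norm nrm (g1 - F y1)) (dual_norm nrm (g0 - F y0)) h5 => a b.
  move: (dual_norm nrm (g1 - g0)) => s h5 s0.
  have : s ^+ 2 <= (a + K + b) ^+ 2 by rewrite lerXn2r// nnegrE (le_trans s0).
  have := sqr_ge0 (a + b - K); have := sqr_ge0 (a - b); nra.
rewrite -(dual_normN hn (F y1 - g1)) (opprB (F y1)) in h2.
set A := dual_norm nrm (g1 - g0) ^+ 2 in h1 h4.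
set E1 := dual_norm nrm (g1 - F y1) ^+ 2 in h2 h4 *.
set E0 := dual_norm nrm (g0 - F y0) ^+ 2 in h4 *.
have ga : 0 <= gam ^+ 2 / (2 * alpha).
  by rewrite divr_ge0 ?sqr_ge0 ?mulr_ge0// ltW.
rewrite [gam ^+ 2 * _]mulrA [gam ^+ 2 * _ / _]mulrAC.
move: (gam ^+ 2 / (2 * alpha)) ga h1 h2 => s s0 h1 h2.
by have := ler_wpM2l s0 h4; move: h1 h2 h3; rewrite !dotE; lra.
Qed.

End mirror_maps.

(** * Measurability of random vectors and of functions of them *)

Section random_vectors.
Context {R : realType} {n : nat} {d : measure_display} {T : measurableType d}.
Implicit Types (p : T -> 'rV[R]_n) (f : T -> R) (U : set 'rV[R]_n).

Lemma random_vector_ball p (v : 'rV[R]_n) (a : R) : random_vector p -> 0 < a ->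
  measurable [set w | `|p w - v| < a].
Proof.
move=> mp a0.
rewrite [X in measurable X](_ : _ =
    \bigcap_(i in [set: 'I_n]) [set w | `|p w 0 i - v 0 i| < a]); last first.
  apply/seteqP; split=> w /=; rewrite norm_lt_coord//.
    by move=> /forallP h i /= _; have := h i; rewrite !mxE.
  by move=> h; apply/forallP => i; rewrite !mxE; exact: h.
apply: fin_bigcap_measurable => // i _.
have : measurable_fun setT (fun w => `|p w 0 i - v 0 i|).
  by apply: measurableT_comp => //; apply: measurable_funB.
move=> /measurable_fun_ltr/(_ (measurable_cst a)).
by move=> /(_ measurableT [set true]); rewrite setTI; exact.
Qed.

(* Rational boxes form a countable base, which makes the product sigma-algebra
   contain all open sets. *)
Lemma random_vector_open p U : random_vector p -> open U ->
  measurable (p @^-1` U).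
Proof.
move=> mp oU.
pose B (rk : 'rV[rat]_n * nat) :=
  [set w | `|p w - map_mx ratr rk.1| < rk.2.+1%:R^-1 :> R].
pose G (rk : 'rV[rat]_n * nat) := if asbool (forall v : 'rV[R]_n,
  `|v - map_mx ratr rk.1| < rk.2.+1%:R^-1 -> U v) then B rk else set0.
have -> : p @^-1` U = \bigcup_rk G rk.
  apply/seteqP; split=> [w /= Uw|w [rk _]]; last first.
    by rewrite /G; case: asboolP => // h /h.
  have /nbhs_ballP[a /= a0 aU] : nbhs (p w) U by apply: open_nbhs_nbhs.
  (* A box of radius below a / 2 whose rational centre is that close to p w lies in the ball of
     radius a around p w. *)
  have [k ak] : exists k : nat, k.+1%:R^-1 < a / 2.
    have a2 : 0 < a / 2 by rewrite divr_gt0.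
    by have [k _ /(_ k (leqnn k))] := near_infty_natSinv_lt (PosNum a2); exists k.
  have k0 : 0 < k.+1%:R^-1 :> R by rewrite invr_gt0.
  have /choice[r hr] : forall i, exists q : rat, `|p w 0 i - ratr q| < k.+1%:R^-1.
    move=> i; have : p w 0 i - k.+1%:R^-1 < p w 0 i + k.+1%:R^-1.
      by rewrite ltrBlDr -addrA ltrDl addr_gt0.
    move=> /rat_in_itvoo[q]; rewrite in_itv /= => /andP[q1 q2].
    by exists q; rewrite ltr_norml ltrBrDl ltrBlDr q2 ltrBlDr -ltrBlDl q1.
  have wr : `|p w - map_mx ratr (\row_i r i)| < k.+1%:R^-1.
    by rewrite norm_lt_coord//; apply/forallP => i; rewrite !mxE.
  exists (\row_i r i, k) => //; rewrite /G asboolT //= => v vr.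
  apply: aU; rewrite mx_norm_ball /ball_/=.
  have := ler_distD (map_mx ratr (\row_i r i)) (p w) v.
  move: vr wr ak => /=; move: (map_mx _ _) (_^-1) => z e.
  by rewrite [`|z - v|]distrC; lra.
apply: countable_bigcupT_measurable => // rk; rewrite /G.
by case: asboolP => // _; exact: random_vector_ball.
Qed.

(** Continuity of [f] is required only between values of [p], which suits gradients that are
    continuous on X and minimizers. A superlevel set of [f] is the preimage under [p] of a union of
    balls centred at values of [p], hence of an open set. *)
Lemma random_vector_comp_measurable p f : random_vector p ->
  (forall w e, 0 < e -> exists2 a : R, 0 < a &
     forall w', `|p w' - p w| < a -> `|f w' - f w| < e) ->
  measurable_fun setT f.
Proof.
move=> mp hf; apply: (measurability _ (RGenOInfty.measurableE R)) => //.
move=> /= _ [_ [b ->] <-]; rewrite setTI.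
pose U := [set v | exists w a, [/\ `|v - p w| < a &
  forall w', `|p w' - p w| < a -> b < f w']].
rewrite (_ : f @^-1` _ = p @^-1` U); last first.
  apply/seteqP; split=> w /=; rewrite in_itv/= andbT; last first.
    by move=> [w0 [a [h]]]; exact.
  move=> bw.
  have [a a0 ha] := hf w (f w - b) ltac:(by rewrite subr_gt0).
  exists w, a; split; first by rewrite subrr normr0.
  by move=> w' /ha; rewrite ltr_norml => /andP[+ _]; lra.
apply: random_vector_open => //; rewrite openE => v [w [a [va ha]]].
apply/nbhs_ballP; exists (a - `|v - p w|); first by rewrite /= subr_gt0.
move=> u; rewrite mx_norm_ball /ball_/= => uv; exists w, a; split => //.
by have := ler_distD v u (p w); rewrite [`|u - v|]distrC; lra.
Qed.

End random_vectors.

Lemma jointly_measurable_domain {R : realType} {n : nat} (d' : measure_display)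
    (Om : measurableType d') (X : set 'rV[R]_n) : closed X ->
  measurable [set q : n.-tuple R * Om | X (\row_j tnth q.1 j)].
Proof.
move=> Xc; rewrite -[X in measurable X]setCK; apply: measurableC.
apply: (@random_vector_open _ _ _ _
  (fun q : n.-tuple R * Om => \row_j tnth q.1 j) (~` X)); last exact: closed_openC.
move=> i; under eq_fun do rewrite mxE.
by apply: (measurableT_comp (measurable_tnth i)).
Qed.

Lemma jointly_measurable_comp {R : realType} {n : nat} (d d' : measure_display)
    (T : measurableType d) (Om : measurableType d') (X : set 'rV[R]_n)
    (Fhat : 'rV[R]_n -> Om -> 'rV[R]_n) (p : T -> 'rV[R]_n) (s : T -> Om) :
  closed X -> jointly_measurable X Fhat -> (forall w, X (p w)) ->
  random_vector p -> measurable_fun setT s ->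
  random_vector (fun w => Fhat (p w) (s w)).
Proof.
move=> Xc mF Xp mp ms i.
pose h w : n.-tuple R * Om := ([tuple p w 0 j | j < n], s w).
have hE w : \row_j tnth (h w).1 j = p w.
  by apply/rowP => j; rewrite mxE tnth_mktuple.
have mh : measurable_fun setT h.
  apply: measurable_fun_pair => //; apply/measurable_fun_tnthP => j.
  rewrite (_ : _ \o _ = fun w => p w 0 j)//.
  by apply/funext => w /=; rewrite tnth_mktuple.
have := measurable_comp (jointly_measurable_domain Xc) _ (mF i) mh.
rewrite (_ : _ \o h = fun w => Fhat (p w) (s w) 0 i).
  by apply=> _ [w _ <-] /=; rewrite hE.
by apply/funext => w /=; rewrite hE.
Qed.

(* No measurability is assumed: the integral of a function is defined through
   the simple functions below its positive and negative parts. *)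
Lemma integral_le (R : realType) (d : measure_display) (T : measurableType d)
    (mu : {measure set T -> \bar R}) (f g : T -> \bar R) :
  (forall w, f w <= g w)%E -> (\int[mu]_w f w <= \int[mu]_w g w)%E.
Proof.
move=> fg; rewrite /integral !patch_setT leeB//; apply: le_ereal_sup.
  move=> _ [h /= hf <-]; exists h => //= w; apply: le_trans (hf w) _.
  by apply: (@funepos_le _ _ setT f g) => [? _|]; rewrite ?inE.
move=> _ [h /= hf <-]; exists h => //= w; apply: le_trans (hf w) _.
by apply: (@funeneg_le _ _ setT f g) => [? _|]; rewrite ?inE.
Qed.

(** The sum rounds x down to a multiple of e. Applied to a function, it is a uniform approximation
    by indicators of superlevel sets. *)
Lemma staircase_approx (R : realType) (e x : R) m :
  0 <= e -> 0 <= x -> x <= m%:R * e ->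
  `|x - \sum_(j < m) e * (j.+1%:R * e <= x)%R%:R| <= e.
Proof.
move=> e0 x0; have full k : k%:R * e <= x ->
    \sum_(j < k) e * (j.+1%:R * e <= x)%R%:R = k%:R * e.
  move=> kx; rewrite (eq_bigr (fun=> e)) ?sumr_const ?card_ord ?mulr_natl// => j _.
  rewrite (le_trans _ kx) ?mulr1// ler_wpM2r// ler_nat; exact: ltn_ord.
elim: m => [|m IH] xm.
  by rewrite mul0r in xm; rewrite big_ord0 subr0 ger0_norm//; exact: le_trans xm _.
have [mx|xm'] := leP (m.+1%:R * e) x.
  by rewrite full// (_ : x = m.+1%:R * e) ?subrr ?normr0//; apply/le_anti/andP.
rewrite big_ord_recr/= [m.+1%:R * e <= x]leNgt xm' mulr0 addr0.
have [/IH//|mx] := leP x (m%:R * e).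
rewrite full ?(ltW mx)// ger0_norm ?subr_ge0 ?(ltW mx)//.
by rewrite lerBlDl -[X in _ <= _ + X]mul1r -mulrDl natr1.
Qed.

(** * Orthogonality of centred noise to variables known from the past *)

Section conditional_orthogonality.
Context {R : realType} {d : measure_display} {W : measurableType d}.
Context (P : probability W R) (gens : set (set W)).
Hypothesis gens_measurable : gens `<=` measurable.

Lemma g_sigma_measurable A : <<s gens >> A -> measurable A.
Proof. by apply: smallest_sub => //; exact: sigma_algebra_measurable. Qed.

Lemma g_sigma_measurable_fun (d' : measure_display) (U : measurableType d')
    (v : W -> U) :
  measurable_fun [set: g_sigma_algebraType gens] v -> measurable_fun [set: W] v.
Proof. by move=> mv _ A mA; apply: g_sigma_measurable; exact: mv. Qed.

Lemma orthogonal_indic (E : W -> R) A :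
  (\int[P]_(w in A) (E w)%:E)%E = 0 -> \int[P]_w (E w * \1_A w) = 0.
Proof.
rewrite integral_mkcond => EA; rewrite /Rintegral -[RHS]/(fine 0) -EA; congr fine.
apply: eq_integral => w _; rewrite patchE indicE.
by case: ifPn => _; rewrite ?mulr1 ?mulr0.
Qed.

(** [E] is orthogonal to indicators of events of the generated sigma-algebra, hence to staircases
    built on superlevel sets of [v]. These approach [v] uniformly, and [E] is integrable. *)
Lemma orthogonal_ge0 (E v : W -> R) (K : R) :
  P.-integrable setT (EFin \o E) ->
  (forall A, <<s gens >> A -> (\int[P]_(w in A) (E w)%:E)%E = 0) ->
  measurable_fun [set: g_sigma_algebraType gens] v ->
  (forall w, 0 <= v w <= K) ->
  \int[P]_w (E w * v w) = 0.
Proof.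
move=> iE E0 mv vK.
have mvW := g_sigma_measurable_fun mv.
have iEb (h : W -> R) c : measurable_fun setT h -> (forall w, `|h w| <= c) ->
    P.-integrable setT (EFin \o (fun w => E w * h w)).
  move=> mh hc; apply: (integrableMl measurableT iE mh).
  by exists c; split; [exact: num_real|] => r cr w _; exact: le_trans (hc w) (ltW cr).
pose C := \int[P]_w `|E w|.
have C0 : 0 <= C by apply: Rintegral_ge0.
have K0 : 0 <= K by have /andP[] := vK point; exact: le_trans.
have step m : `|\int[P]_w (E w * v w)| <= C * (K / m.+1%:R).
  pose e := K / m.+1%:R.
  pose A (j : nat) := [set w | j.+1%:R * e <= v w].
  have mA j : <<s gens >> (A j).
    have := mv measurableT _ (measurable_itv `[(j.+1%:R * e), +oo[).
    by rewrite setTI preimage_itvcy.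
  pose s w := \sum_(j < m.+1) e * \1_(A j) w.
  have vs w : `|v w - s w| <= e.
    have /andP[v0 v1] := vK w.
    have := @staircase_approx _ e _ m.+1 (divr_ge0 K0 (ler0n _ _)) v0.
    rewrite /e mulrCA divff ?pnatr_eq0// mulr1.
    move=> /(_ v1); congr (`|_ - _| <= _); apply: eq_bigr => j _.
    rewrite indicE; congr (_ * (nat_of_bool _)%:R).
    by apply/idP/idP; rewrite inE.
  have ms : measurable_fun setT s.
    apply: measurable_sum => j; apply: measurable_funM => //.
    by apply: measurable_indic; exact: g_sigma_measurable.
  have Es : \int[P]_w (E w * s w) = 0.
    rewrite /s; elim: (m.+1) => [|k IH].
      under eq_Rintegral do rewrite big_ord0 mulr0.
      by rewrite Rintegral_cst// mul0r.
    under eq_Rintegral do rewrite big_ord_recr/= mulrDr mulrCA.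
    have m1 : measurable_fun setT (\1_(A k) : W -> R).
      by apply: measurable_indic; exact: g_sigma_measurable.
    have i1 : P.-integrable setT (EFin \o (fun w => E w * \1_(A k) w)).
      apply: (iEb _ 1) => // w; rewrite indicE.
      by case: (_ \in _); rewrite ?normr1 ?normr0.
    rewrite RintegralD//.
    - by rewrite IH RintegralZl// orthogonal_indic ?mulr0 ?addr0//; exact: E0.
    - apply: (iEb _ (\sum_(j < k) `|e|)).
        apply: measurable_sum => j; apply: measurable_funM => //.
        by apply: measurable_indic; exact: g_sigma_measurable.
      move=> w; apply: le_trans (ler_norm_sum _ _ _) _; apply: ler_sum => j _.
      by rewrite indicE; case: (_ \in _); rewrite ?mulr1 ?mulr0 ?normr0.
    - exact: (integrableZl measurableT e i1).
  have iv : P.-integrable setT (EFin \o (fun w => E w * v w)).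
    by apply: (iEb _ K) => // w; have /andP[v0 v1] := vK w; rewrite ger0_norm.
  have ivs : P.-integrable setT (EFin \o (fun w => E w * (v w - s w))).
    by apply: (iEb _ e) => //; exact: measurable_funB.
  have -> : \int[P]_w (E w * v w) = \int[P]_w (E w * (v w - s w)).
    rewrite -[LHS]subr0 -[X in _ - X]Es -RintegralB//.
    - by apply: eq_Rintegral => w _; rewrite mulrBr.
    - apply: (iEb _ (K + e)) => // w; have /andP[v0 v1] := vK w.
      by have := vs w; rewrite !ler_norml => /andP[? ?]; apply/andP; split; lra.
  apply: le_trans (le_normr_Rintegral _ _) _ => //.
  have iaE : P.-integrable setT (EFin \o (fun w => `|E w|)).
    exact: integrable_norm.
  rewrite -/e -RintegralZr//; apply: le_Rintegral => //.
  - exact: integrable_norm.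
  - exact: (integrableZr measurableT e iaE).
  - by move=> w _; rewrite normrM ler_wpM2l.
(* The bound C K / (m + 1) holds for every m, so a nonzero integral is contradicted by taking m
   large. *)
apply/eqP; rewrite -normr_eq0 eq_le normr_ge0 andbT leNgt; apply/negP => I0.
have CK : 0 < C * K + 1 by rewrite ltr_wpDl ?mulr_ge0.
have e0 : 0 < `|\int[P]_w (E w * v w)| / (C * K + 1) by rewrite divr_gt0.
have [m _ /(_ m (leqnn m)) /=] := near_infty_natSinv_lt (PosNum e0).
rewrite ltNge => /negP; apply; rewrite ler_pdivrMr//.
apply: le_trans (step m) _; rewrite mulrA mulrC ler_wpM2l ?invr_ge0//.
by rewrite lerDl.
Qed.

(** The shift v + K takes values in [0, 2 K], and it does not change the integral because [E] itself
    has mean zero. *)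
Lemma orthogonal_bounded (E v : W -> R) (K : R) :
  P.-integrable setT (EFin \o E) ->
  (forall A, <<s gens >> A -> (\int[P]_(w in A) (E w)%:E)%E = 0) ->
  measurable_fun [set: g_sigma_algebraType gens] v ->
  (forall w, `|v w| <= K) ->
  P.-integrable setT (EFin \o (fun w => E w * v w)) /\
  \int[P]_w (E w * v w) = 0.
Proof.
move=> iE E0 mv vK.
have iEv : P.-integrable setT (EFin \o (fun w => E w * v w)).
  apply: (integrableMl measurableT iE (g_sigma_measurable_fun mv)).
  by exists K; split; [exact: num_real|] => r cr w _; exact: le_trans (vK w) (ltW cr).
split => //.
have iEK : P.-integrable setT (EFin \o (fun w => E w * K)).
  exact: (integrableZr measurableT K iE).
have vK2 w : 0 <= v w + K <= 2 * K.
  by have := vK w; rewrite ler_norml => /andP[? ?]; apply/andP; split; lra.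
have := orthogonal_ge0 iE E0 (measurable_funD mv (measurable_cst K)) vK2.
under eq_Rintegral do rewrite mulrDr.
rewrite RintegralD// RintegralZr//.
have -> : \int[P]_w E w = 0.
  by rewrite /Rintegral (E0 setT)//; exact: (@measurableT _ (g_sigma_algebraType gens)).
by rewrite mul0r addr0.
Qed.

End conditional_orthogonality.

(** * Upper bounds on expectations *)

Section mean_le.
Context {R : realType} {d : measure_display} {W : measurableType d}.
Context (P : probability W R).
Implicit Types f g : W -> R.

(** Integrability travels with the bound, so that bounds can be added and scaled directly. *)
Definition mean_le f (r : R) : Prop :=
  P.-integrable setT (EFin \o f) /\ \int[P]_w f w <= r.

Lemma mean_le_cst (r : R) : mean_le (cst r) r.
Proof.
split; first exact: finite_measure_integrable_cst.
by rewrite Rintegral_cst//= probability_setT mulr1.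
Qed.

Lemma mean_leD f g a b : mean_le f a -> mean_le g b ->
  mean_le (fun w => f w + g w) (a + b).
Proof.
move=> [fi fa] [gi gb]; split; first exact: (integrableD measurableT fi gi).
by rewrite RintegralD// lerD.
Qed.

Lemma mean_leZ f a (k : R) : 0 <= k -> mean_le f a ->
  mean_le (fun w => k * f w) (k * a).
Proof.
move=> k0 [fi fa]; split; first exact: (integrableZl measurableT k fi).
by rewrite RintegralZl// ler_wpM2l.
Qed.

Lemma mean_le_sum (I : Type) (r : seq I) (f : I -> W -> R) (a : I -> R) :
  (forall i, mean_le (f i) (a i)) ->
  mean_le (fun w => \sum_(i <- r) f i w) (\sum_(i <- r) a i).
Proof.
move=> fa; elim: r => [|i r IH].
  under eq_fun do rewrite big_nil; rewrite big_nil; exact: mean_le_cst.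
by under eq_fun do rewrite big_cons; rewrite big_cons; exact: mean_leD.
Qed.

Lemma mean_le_integral f a : mean_le f a -> (\int[P]_w (f w)%:E <= a%:E)%E.
Proof.
move=> [fi fa]; rewrite -(fineK (integrable_fin_num _ fi))//.
Qed.

Lemma mean_le_cond_expectation gens f V (r : R) :
  cond_expectation P gens f V -> {ae P, forall w, V w <= r} -> mean_le f r.
Proof.
move=> [fi Vi _ fV] [N [mN N0 hN]]; split => //.
have -> : \int[P]_w f w = \int[P]_w V w.
  congr fine; apply: fV; exact: (@measurableT _ (g_sigma_algebraType gens)).
have iC : P.-integrable setT (EFin \o cst r).
  exact: finite_measure_integrable_cst.
have : (\int[P]_w (V w)%:E <= \int[P]_w (cst r w)%:E)%E.
  (* The bound on [V] holds only almost surely, so both integrals are first restricted to the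
     complement of the null set [N]. *)
  rewrite (negligible_integral mN _ Vi N0)// (negligible_integral mN _ iC N0)//.
  have mS : measurable (setT `\` N) by exact: measurableD.
  apply: le_integral => //.
  - exact: (@integrableS _ _ _ _ setT _ _ measurableT).
  - exact: (@integrableS _ _ _ _ setT _ _ measurableT).
  move=> w /set_mem[_ Nw]; rewrite lee_fin leNgt; apply/negP => rV; apply: Nw.
  by apply: hN => /= /le_lt_trans/(_ rV); rewrite ltxx.
have -> : (\int[P]_w (cst r w)%:E = r%:E)%E.
  by rewrite (integral_cst P measurableT r%:E) /= probability_setT mule1.
by rewrite -(fineK (integrable_fin_num _ Vi))// lee_fin.
Qed.

End mean_le.

(** * Sigma-algebras generated by the past *)

Section generated_histories.
Context {R : realType} {n : nat} {d : measure_display} {W : measurableType d}.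
Context {d' : measure_display} {Om : measurableType d'}.
Implicit Types (G H : set (set W)) (p : W -> 'rV[R]_n).

Definition sub_random_vector G p : Prop :=
  @random_vector R n _ (g_sigma_algebraType G) p.

Lemma g_sigma_measurable_funS (d1 : measure_display) (U : measurableType d1)
    G H (v : W -> U) : G `<=` H ->
  measurable_fun [set: g_sigma_algebraType G] v ->
  measurable_fun [set: g_sigma_algebraType H] v.
Proof.
move=> GH mv _ A mA; have := mv measurableT A mA.
by apply: smallest_sub; [exact: smallest_sigma_algebra|
  move=> B /GH; exact: sub_sigma_algebra].
Qed.

Lemma history_le (x0 : W -> 'rV[R]_n) (xi : nat -> W -> Om) s t :
  (s <= t)%N -> history x0 xi s `<=` history x0 xi t.
Proof.
move=> st A [|[k /= ks hA]]; [by left|right; exists k => //=].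
exact: leq_trans ks st.
Qed.

Lemma history_measurable (x0 : W -> 'rV[R]_n) (xi : nat -> W -> Om) t :
  random_vector x0 -> (forall k, measurable_fun setT (xi k)) ->
  history x0 xi t `<=` measurable.
Proof.
by move=> mx mxi A [[i _ [B mB <-]]|[k _ [B mB <-]]];
  [exact: mx|exact: mxi].
Qed.

Lemma history_x0 (x0 : W -> 'rV[R]_n) (xi : nat -> W -> Om) t :
  sub_random_vector (history x0 xi t) x0.
Proof.
move=> i _ B mB; apply: sub_sigma_algebra; left; exists i => //; exists B => //.
Qed.

Lemma history_sample (x0 : W -> 'rV[R]_n) (xi : nat -> W -> Om) k t :
  (k < t)%N -> measurable_fun [set: g_sigma_algebraType (history x0 xi t)] (xi k).
Proof.
by move=> kt _ B mB; apply: sub_sigma_algebra; right; exists k => //; exists B.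
Qed.

End generated_histories.

(** * Measurability of mirror steps *)

Section mirror_measurability.
Context {R : realType} {n : nat} (nrm : 'rV[R]_n -> R) (hn : is_norm nrm).
Context (X : set 'rV[R]_n).
Hypothesis Xconvex : convex_set (X : set (convex_lmodType 'rV[R]_n)).
Context (psi : 'rV[R]_n -> R) (gpsi : 'rV[R]_n -> 'rV[R]_n) (alpha : R).
Hypothesis psiC1 : C1_on X psi gpsi.
Hypothesis alpha0 : 0 < alpha.
Hypothesis psi_sc : strongly_convex_on X nrm psi gpsi alpha.
Context {d : measure_display} {T : measurableType d}.
Implicit Types p q : T -> 'rV[R]_n.

Lemma random_vector_gradient p : (forall w, X (p w)) -> random_vector p ->
  random_vector (gpsi \o p).
Proof.
move=> Xp mp i; apply: (random_vector_comp_measurable mp) => w e e0.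
have [a a0 ha] := C1_on_gradient_continuous psiC1 (Xp w) e0.
exists a => // w' /(ha _ (Xp w')); apply: le_lt_trans.
by have := coord_le_norm (gpsi (p w') - gpsi (p w)) i; rewrite !mxE.
Qed.

(** The minimizer is a Lipschitz function of the linear term, so any pointwise choice of minimizers
    is measurable. *)
Lemma random_vector_argmin q p : random_vector q ->
  (forall w, is_argmin X (fun z => dot (q w) z + psi z) (p w)) ->
  random_vector p.
Proof.
move=> mq hp i; have [C C0 hC] := argmin_lipschitz hn Xconvex psiC1 alpha0 psi_sc.
apply: (random_vector_comp_measurable mq) => w e e0.
exists (e / C); first by rewrite divr_gt0.
move=> w'; rewrite ltr_pdivlMr// mulrC; apply: le_lt_trans.
apply: le_trans (hC _ _ _ _ (hp w') (hp w)).
by have := coord_le_norm (p w' - p w) i; rewrite !mxE.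
Qed.

Lemma random_vector_mirror g x p (c : R) :
  (forall w, X (x w)) -> random_vector x -> random_vector g ->
  (forall w, is_argmin X (fun z => dot (c *: g w - gpsi (x w)) z + psi z) (p w)) ->
  random_vector p.
Proof.
move=> Xx mx mg; apply: (random_vector_argmin (q := fun w => c *: g w - gpsi (x w))).
move=> i; under eq_fun do rewrite !mxE.
apply: measurable_funB; first by apply: measurable_funM => //; exact: mg.
exact: random_vector_gradient.
Qed.

End mirror_measurability.

(** * Comparison of the constants *)

Definition variation_bound {R : realType} (nu L M alpha D : R) : R :=
  L * (2 * D / alpha) `^ (nu / 2) + M.

(** Strong convexity and the bound D on the divergence give |x - y|^2 <= 2 D / alpha, which is
    inserted into the growth condition. *)
Lemma growth_variation_bound {R : realType} {n : nat} (nrm : 'rV[R]_n -> R)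
    (X : set 'rV[R]_n) psi gpsi F (nu L M alpha D : R) x y :
  is_norm nrm -> 0 < alpha -> strongly_convex_on X nrm psi gpsi alpha ->
  (forall x z, X x -> X z -> bregman psi gpsi z x <= D) ->
  0 <= nu -> 0 < L -> growth_on X nrm F nu L M -> X x -> X y ->
  dual_norm nrm (F x - F y) <= variation_bound nu L M alpha D.
Proof.
move=> hn alpha0 sc hD nu0 L0 hF Xx Xy; apply: le_trans (hF _ _ Xx Xy) _.
rewrite lerD2r ler_wpM2l ?(ltW L0)//.
have r0 := is_norm_ge0 hn (x - y).
have hr : nrm (x - y) ^+ 2 <= 2 * D / alpha.
  rewrite ler_pdivlMr//; have := bregman_ge_norm sc Xy Xx; have := hD _ _ Xy Xx.
  by move=> h1 h2; have := le_trans h2 h1; lra.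
have -> : nrm (x - y) `^ nu = (nrm (x - y) ^+ 2) `^ (nu / 2).
  by rewrite -powR_mulrn// -powRrM mulrCA divff ?mulr1.
have D0 := le_trans (sqr_ge0 _) hr.
by apply: ge0_ler_powR hr; rewrite ?nnegrE ?sqr_ge0// divr_ge0.
Qed.

(** For nu > 0, with r^2 = (2 D / alpha)^nu, it follows from 2 (L r + M)^2 <= 4 L^2 r^2 + 4 M^2 <= 8
    L^2 r^2 + 16 M^2. For nu = 0 the two sides are equal. *)
Lemma Dhat_ge {R : realType} (nu L M alpha D sigma : R) :
  0 <= nu -> 0 < alpha -> 0 < D ->
  (2 * variation_bound nu L M alpha D ^+ 2 + 9 * sigma ^+ 2) / (2 * alpha)
    <= Dhat nu L M alpha D sigma.
Proof.
move=> nu0 alpha0 D0; rewrite /Dhat /variation_bound; case: ifPn => [nu_gt0|].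
  set r := (2 * D / alpha) `^ (nu / 2).
  have r2 : r ^+ 2 = 2 `^ nu * D `^ nu / alpha `^ nu.
    rewrite /r -powR_mulrn ?powR_ge0// -powRrM divfK//.
    by rewrite powRM ?mulr_ge0 ?invr_ge0 ?(ltW D0) ?(ltW alpha0)// powRM ?(ltW D0)//
      -powR_inv1 ?(ltW alpha0)// -powRrM mulN1r powRN.
  have -> : 2 `^ (2 + nu) * L ^+ 2 * D `^ nu / alpha `^ (1 + nu) =
      8 * (L ^+ 2 * r ^+ 2) / (2 * alpha).
    rewrite r2 !powRD ?pnatr_eq0 ?(gt_eqF alpha0) ?implybT//.
    rewrite !powRr1 ?(ltW alpha0)//.
    have : alpha `^ nu != 0 by rewrite gt_eqF// powR_gt0.
    by move: (alpha `^ nu) => a a0; field; rewrite a0 gt_eqF.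
  rewrite -mulrDl ler_wpM2r ?invr_ge0 ?mulr_ge0 ?(ltW alpha0)//.
  have := sqr_ge0 (L * r - M); have := sqr_ge0 (L * r); have := sqr_ge0 M.
  have := sqr_ge0 sigma; nra.
rewrite -leNgt => nu_le0; have -> : nu = 0 by apply/le_anti/andP.
by rewrite mul0r powRr0 mulr1 addrC.
Qed.

(** * The stochastic Popov iterates and their averaged gap *)

Section popov.
Context {R : realType} {n : nat} (nrm : 'rV[R]_n -> R) (hn : is_norm nrm).
Context (X : set 'rV[R]_n).
Hypothesis Xclosed : closed X.
Hypothesis Xconvex : convex_set (X : set (convex_lmodType 'rV[R]_n)).
Hypothesis Xbounded : bounded_set X.
Context (psi : 'rV[R]_n -> R) (gpsi : 'rV[R]_n -> 'rV[R]_n) (alpha : R).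
Hypothesis psiC1 : C1_on X psi gpsi.
Hypothesis alpha0 : 0 < alpha.
Hypothesis psi_sc : strongly_convex_on X nrm psi gpsi alpha.
Context (F : 'rV[R]_n -> 'rV[R]_n) (K : R).
Hypothesis Fmono : monotone_on X F.
Hypothesis F_K : forall x y, X x -> X y -> dual_norm nrm (F x - F y) <= K.
Context {d : measure_display} {W : measurableType d} (P : probability W R).
Context {d' : measure_display} {Om : measurableType d'}.
Context (Fhat : 'rV[R]_n -> Om -> 'rV[R]_n).
Hypothesis Fhat_meas : jointly_measurable X Fhat.
Context (gam : nat -> R) (xi : nat -> W -> Om) (x y : nat -> W -> 'rV[R]_n).
Hypothesis gam0 : forall t, 0 < gam t.
Hypothesis xi_meas : forall t, measurable_fun setT (xi t).
Hypothesis x0_rv : random_vector (x 0%N).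
Hypothesis xy_popov : popov_iterates X psi gpsi Fhat xi gam x y.
Context (sigma : R).
Hypothesis sampling_y : forall t,
  sampling_at P nrm F Fhat sigma (history (x 0%N) xi t) (y t) (xi t).
Context (D : R).
Hypothesis bregmanD : forall x z, X x -> X z -> bregman psi gpsi z x <= D.

Let g t w := Fhat (y t w) (xi t w).
Let e t w := g t w - F (y t w).
Let H t := history (x 0%N) xi t.

Let Xx t w : X (x t w).
Proof.
by case: t => [|t]; [exact: popov_x0 xy_popov w|
  exact: (popov_x xy_popov t w).1].
Qed.

Let Xy t w : X (y t w).
Proof.
by case: t => [|t]; [rewrite (popov_y0 xy_popov)|
  exact: (popov_y xy_popov t w).1].
Qed.

Let H_measurable t : H t `<=` measurable.
Proof. exact: history_measurable. Qed.

Let sub_random_vectorS t (p : W -> 'rV[R]_n) :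
  sub_random_vector (H t) p -> sub_random_vector (H t.+1) p.
Proof.
by move=> mp i; apply: g_sigma_measurable_funS (mp i); exact: history_le.
Qed.

Let sample_measurable t : sub_random_vector (H t) (y t) ->
  sub_random_vector (H t.+1) (g t).
Proof.
move=> my; apply: (@jointly_measurable_comp _ _ _ _
  (g_sigma_algebraType (H t.+1)) _ X) => //; first exact: sub_random_vectorS.
exact: history_sample.
Qed.

(** The indices differ because y_t is computed before xi_t is drawn, while x_t for t > 0 uses xi_t.
    Each update of one sequence needs the other, hence the joint induction. *)
Lemma popov_measurable t :
  sub_random_vector (H t) (y t) /\ sub_random_vector (H t.+1) (x t).
Proof.
have next_y s : sub_random_vector (H s) (y s) -> sub_random_vector (H s.+1) (x s) ->
    sub_random_vector (H s.+1) (y s.+1).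
  move=> my mx; apply: (random_vector_mirror hn Xconvex psiC1 alpha0 psi_sc
    (T := g_sigma_algebraType (H s.+1)) (Xx s) mx (sample_measurable my)).
  exact: (popov_y xy_popov s).
elim: t => [|t [my mx]].
  split; last exact: history_x0.
  by rewrite (_ : y 0%N = x 0%N); [exact: history_x0|exact/funext/(popov_y0 xy_popov)].
have my1 := next_y _ my mx; split => //.
apply: (random_vector_mirror hn Xconvex psiC1 alpha0 psi_sc
  (T := g_sigma_algebraType (H t.+2)) (Xx t) _ (sample_measurable my1)).
  exact: sub_random_vectorS.
exact: (popov_x xy_popov t).
Qed.

(** These are the mirror descent iterates to which [gap_step] is applied. Since u_t uses samples up
    to xi_t only, it is known before xi_(t+1) is drawn. *)
Lemma noise_iterates : exists u : nat -> W -> 'rV[R]_n,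
  [/\ forall t w, X (u t w),
      forall t w, is_argmin X (fun z => dot (gam t *:
        (F (y t.+1 w) - g t.+1 w) - gpsi (u t w)) z + psi z) (u t.+1 w) &
      forall t, sub_random_vector (H t.+1) (u t)].
Proof.
have X0 : X !=set0 by exists (x 0%N point); exact: Xx.
have /choice[prox hprox] := fun q => exists_argmin Xclosed Xbounded psiC1 q X0.
pose u := fix u t w := if t is s.+1 then
  prox (gam s *: (F (y s.+1 w) - g s.+1 w) - gpsi (u s w)) else x 0%N w.
have Xu t w : X (u t w) by case: t => [|t] /=; [exact: Xx|exact: (hprox _).1].
exists u; split => [//|t w|]; first exact: hprox.
elim=> [|t mu]; first exact: history_x0.
apply: (random_vector_mirror hn Xconvex psiC1 alpha0 psi_sc
  (T := g_sigma_algebraType (H t.+2)) (x := u t) (c := gam t)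
  (g := fun w => F (y t.+1 w) - g t.+1 w)) => [//||i|w]; last exact: hprox.
  exact: sub_random_vectorS.
under eq_fun do rewrite !mxE; apply: measurable_funB; last first.
  by apply: sample_measurable; exact: (popov_measurable _).1.
(* Measurability of F(y_(t+1)) is part of the unbiasedness condition, where it is the conditional
   expectation of the sample. *)
have [/(_ i)[_ _ + _] _] := sampling_y t.+1.
by apply: g_sigma_measurable_funS; exact: history_le.
Qed.

Lemma noise_variance t :
  mean_le P (fun w => dual_norm nrm (e t w) ^+ 2) (sigma ^+ 2).
Proof.
by have [_ [V [hV Vs]]] := sampling_y t; exact: mean_le_cond_expectation hV Vs.
Qed.

(** Unbiasedness makes each noise coordinate integrate to zero on past events; orthogonality to the
    bounded coordinates of [p] is then summed. *)
Lemma noise_orthogonal t (p : W -> 'rV[R]_n) (C : R) :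
  sub_random_vector (H t) p ->
  (forall w, `|p w| <= C) -> mean_le P (fun w => dot (e t w) (p w)) 0.
Proof.
move=> mp pC.
rewrite (_ : 0 = \sum_(i < n) (0 : R)); last by rewrite big1.
apply: mean_le_sum => i.
have [/(_ i)[gi Fi mF gF] _] := sampling_y t.
have ei : P.-integrable setT (EFin \o (fun w => e t w 0 i)).
  apply: eq_integrable (integrableB measurableT gi Fi) => // w _ /=.
  by rewrite !mxE.
have e0 A : <<s H t >> A -> (\int[P]_(w in A) (e t w 0 i)%:E)%E = 0.
  move=> HA; have mA := g_sigma_measurable (@H_measurable t) HA.
  have iA f : P.-integrable setT f -> P.-integrable A f.
    exact: (@integrableS _ _ _ _ setT _ _ measurableT).
  under eq_integral do rewrite !mxE EFinB.
  rewrite integralB//; [|exact: iA|exact: iA].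
  rewrite gF// subee// integrable_fin_num//; exact: iA.
have pC' w : `|p w 0 i| <= C by exact: le_trans (coord_le_norm _ _) (pC w).
have [iE E0] := orthogonal_bounded (@H_measurable t) ei e0 (mp i) pC'.
by split => //; rewrite E0.
Qed.

(** [gap_step] is summed over t for a fixed outcome and arbitrary z. The resulting bound does not
    depend on z, so it dominates the supremum, and expectation is taken afterwards. *)
Lemma weighted_gap_bound s T : (s <= T)%N ->
  (\int[P]_w dual_gap X F ((\sum_(s <= t < T.+1) gam t)^-1
     *: \sum_(s <= t < T.+1) gam t *: y t.+1 w)%R <=
   ((\sum_(s <= t < T.+1) gam t)^-1 * (2 * D + \sum_(s <= t < T.+1) gam t ^+ 2 *
      ((2 * K ^+ 2 + 9 * sigma ^+ 2) / (2 * alpha))))%:E)%E.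
Proof.
move=> sT; set Gam := \sum_(s <= t < T.+1) gam t.
have Gam0 : 0 < Gam.
  rewrite /Gam big_nat_recr//= ltr_wpDl ?gam0// sumr_ge0// => t _.
  exact: ltW.
have [u [Xu hu mu]] := noise_iterates.
have [C _ hC] : exists2 C : R, True & forall v, X v -> `|v| <= C.
  by have [C [_ hC]] := Xbounded; exists (C + 1) => // v; apply: hC; rewrite ltrDl.
pose v t w := ((2 * K ^+ 2 + 5 * dual_norm nrm (e t.+1 w) ^+ 2
   + 4 * dual_norm nrm (e t w) ^+ 2) / (2 * alpha)).
pose h w := Gam^-1 * (2 * D + \sum_(s <= t < T.+1)
   (gam t ^+ 2 * v t w + gam t * dot (e t.+1 w) (u t w - y t.+1 w))).
have gap_le w : (dual_gap X F (Gam^-1 *: \sum_(s <= t < T.+1) gam t *: y t.+1 w)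
    <= (h w)%:E)%E.
  apply: ge_ereal_sup => _ [z Xz <-]; rewrite lee_fin.
  rewrite dotDr dotZr dot_sumr dotNr.
  have -> : Gam^-1 * \sum_(s <= t < T.+1) dot (F z) (gam t *: y t.+1 w) - dot (F z) z
      = Gam^-1 * \sum_(s <= t < T.+1) gam t * dot (F z) (y t.+1 w - z).
    rewrite -[dot (F z) z](mulKf (lt0r_neq0 Gam0)) -mulrBr; congr (_ * _).
    rewrite /Gam mulr_suml -sumrB; apply: eq_bigr => t _.
    by rewrite !dotE mulrBr.
  rewrite ler_wpM2l ?invr_ge0 ?(ltW Gam0)//.
  (* This potential telescopes: it is at most 2 D at time s and nonnegative at time T + 1. *)
  pose B t := bregman psi gpsi z (x t w) + bregman psi gpsi z (u t w).
  apply: (@le_trans _ _ (\sum_(s <= t < T.+1) ((gam t ^+ 2 * v t w +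
      gam t * dot (e t.+1 w) (u t w - y t.+1 w)) - (B t.+1 - B t)))).
    apply: ler_sum => t _.
    have := gap_step hn Xconvex psiC1 alpha0 psi_sc Fmono
      (F_K (Xy t.+1 w) (Xy t w)) (ltW (gam0 t)) (Xx t w) (Xu t w) Xz
      (popov_y xy_popov t w) (popov_x xy_popov t w) (hu t w).
    by rewrite /B /v /e /g !dotE; lra.
  rewrite sumrB telescope_sumr ?(leq_trans sT)// addrC lerD2r.
  have := bregmanD (Xx s w) Xz; have := bregmanD (Xu s w) Xz.
  have := bregman_ge0 alpha0 psi_sc (Xx T.+1 w) Xz.
  have := bregman_ge0 alpha0 psi_sc (Xu T.+1 w) Xz.
  rewrite /B; lra.
apply: le_trans (integral_le _ gap_le) _; apply: mean_le_integral.
apply: mean_leZ; first by rewrite invr_ge0 ltW.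
apply: mean_leD; first exact: mean_le_cst.
apply: mean_le_sum => t; rewrite -[X in mean_le _ _ X]addr0.
apply: mean_leD.
  apply: mean_leZ; first exact: sqr_ge0.
  (* The 9 splits into the weights 5 and 4 of the noise at times t + 1 and t. *)
  rewrite mulrC (_ : 2 * _ + 9 * _ = 2 * K ^+ 2 + 5 * sigma ^+ 2 + 4 * sigma ^+ 2);
    last by ring.
  rewrite /v; under eq_fun do rewrite mulrC.
  apply: mean_leZ; first by rewrite invr_ge0 mulr_ge0// ltW.
  apply: mean_leD; [apply: mean_leD; first exact: mean_le_cst|].
    by apply: mean_leZ => //; exact: noise_variance.
  by apply: mean_leZ => //; exact: noise_variance.
rewrite -(mulr0 (gam t)); apply: mean_leZ; first exact: ltW.
(* Both u_t and y_(t+1) are known before xi_(t+1) is drawn, and both lie in the bounded set X. *)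
apply: (@noise_orthogonal _ _ (C + C)) => [i|w].
  under eq_fun do rewrite !mxE.
  by apply: measurable_funB; [exact: mu|exact: (popov_measurable _).1].
by apply: le_trans (ler_normB _ _) _; rewrite lerD// hC.
Qed.

End popov.

(** * Sums of step sizes and conclusion *)

Lemma ln4_ge1 (R : realType) : 1 <= ln (4 : R).
Proof.
rewrite -[leLHS]expRK ler_ln ?posrE ?expR_gt0//.
(* From exp(-1/2) >= 1 - 1/2 follows exp(1/2) <= 2, and squaring gives e <= 4. *)
have h : expR (- 2^-1) >= 2^-1 :> R by have := expR_ge1Dx (- 2^-1 : R); lra.
have {}h : expR 2^-1 <= 2 :> R.
  by rewrite -[leLHS]invrK -expRN -[leRHS]invrK lef_pV2 ?posrE ?invr_gt0 ?expR_gt0.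
rewrite (_ : 1 = 2^-1 + 2^-1 :> R) ?expRD; last by lra.
have := expR_gt0 (2^-1 : R); nra.
Qed.

Lemma constant_step_sums (R : realType) (gam : nat -> R) (c : R) T :
  (forall t, (t <= T)%N -> gam t = c / Num.sqrt T.+1%:R) ->
  \sum_(0 <= t < T.+1) gam t = c * Num.sqrt T.+1%:R /\
  \sum_(0 <= t < T.+1) gam t ^+ 2 = c ^+ 2.
Proof.
set q := Num.sqrt _ => hg; have q2 : q ^+ 2 = T.+1%:R by rewrite sqr_sqrtr.
have q0 : q != 0 by rewrite gt_eqF// sqrtr_gt0.
split.
  rewrite (eq_big_nat _ _ (F2 := fun=> c / q)) => [|t /andP[_ /hg]//].
  by rewrite sumr_const_nat subn0 -mulr_natr -q2; field.
rewrite (eq_big_nat _ _ (F2 := fun=> (c / q) ^+ 2)) => [|t /andP[_ /hg->]//].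
by rewrite sumr_const_nat subn0 -mulr_natr -q2; field.
Qed.

(** The window has at least (T + 1) / 2 terms, each at least c / sqrt (T + 1). It also has at most
    [(uphalf T).+1] terms, whose squares are at most c^2 / [(uphalf T).+1]; so the squares sum to at
    most c^2, and ln 4 >= 1. *)
Lemma decreasing_step_sums (R : realType) (gam : nat -> R) (c : R) T : 0 < c ->
  (forall t, (t <= T)%N -> gam t = c / Num.sqrt t.+1%:R) ->
  c * Num.sqrt T.+1%:R <= 2 * \sum_(uphalf T <= t < T.+1) gam t /\
  \sum_(uphalf T <= t < T.+1) gam t ^+ 2 <= c ^+ 2 * ln 4.
Proof.
move=> c0 hg; have q0 k : 0 < Num.sqrt (k.+1%:R : R) by rewrite sqrtr_gt0.
split.
  apply: (@le_trans _ _ (2 * \sum_(uphalf T <= t < T.+1) c / Num.sqrt T.+1%:R)).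
    rewrite sumr_const_nat -[_ *+ (_ - _)]mulr_natr.
    have : Num.sqrt T.+1%:R ^+ 2 <= 2 * (T.+1 - uphalf T)%:R :> R.
      by rewrite sqr_sqrtr// -natrM ler_nat; lia.
    have := q0 T; move: (Num.sqrt _) => q qT h; rewrite mulrCA.
    rewrite (_ : c * q = c / q * q ^+ 2); last by field; rewrite gt_eqF.
    by rewrite ler_wpM2l// divr_ge0// ltW.
  rewrite ler_wpM2l// !big_nat ler_sum// => t /andP[_ tT].
  rewrite hg// ler_wpM2l ?(ltW c0)// lef_pV2 ?posrE//.
  by rewrite ler_wsqrtr// ler_nat.
apply: (@le_trans _ _ (\sum_(uphalf T <= t < T.+1) c ^+ 2 / (uphalf T).+1%:R)).
  rewrite !big_nat ler_sum// => t /andP[st tT].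
  rewrite hg// exprMn exprVn sqr_sqrtr// ler_wpM2l ?sqr_ge0// lef_pV2 ?posrE//.
  by rewrite ler_nat.
rewrite sumr_const_nat -[_ *+ (_ - _)]mulr_natr -mulrA ler_wpM2l ?sqr_ge0//.
apply: le_trans (ln4_ge1 R); rewrite ler_pdivrMl// mulr1 ler_nat; lia.
Qed.

Theorem theorem6 (R : realType) (n : nat)
  (nrm : 'rV[R]_n -> R) (nrm_norm : is_norm nrm)
  (X : set 'rV[R]_n) (X0 : X !=set0) (Xclosed : closed X)
  (Xconvex : convex_set (X : set (convex_lmodType 'rV[R]_n)))
  (Xbounded : bounded_set X)
  (psi : 'rV[R]_n -> R) (gpsi : 'rV[R]_n -> 'rV[R]_n) (alpha : R)
  (psiC1 : C1_on X psi gpsi) (alpha0 : 0 < alpha)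
  (psi_sc : strongly_convex_on X nrm psi gpsi alpha)
  (F : 'rV[R]_n -> 'rV[R]_n) (Fmono : monotone_on X F)
  (nu L M : R) (nu0 : 0 <= nu) (L0 : 0 < L) (M0 : 0 <= M)
  (Fgrowth : growth_on X nrm F nu L M)
  (d : measure_display) (W : measurableType d) (P : probability W R)
  (d' : measure_display) (Om : measurableType d')
  (Fhat : 'rV[R]_n -> Om -> 'rV[R]_n) (Fhat_meas : jointly_measurable X Fhat)
  (xi : {RV P >-> Om}) (Fmean : mean_operator P X Fhat F xi)
  (gam : nat -> R) (gam0 : forall t, 0 < gam t)
  (xis : nat -> {RV P >-> Om}) (x y : nat -> W -> 'rV[R]_n)
  (x0_rv : random_vector (x 0%N))
  (x0_L2 : ('E_P[(fun w => nrm (x 0%N w) ^+ 2)%R] < +oo)%E)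
  (xy_popov : popov_iterates X psi gpsi Fhat xis gam x y)
  (sigma : R)
  (sampling_cst : forall z t, X z ->
    sampling_at P nrm F Fhat sigma (history (x 0%N) xis t) (cst z) (xis t))
  (sampling_y : forall t,
    sampling_at P nrm F Fhat sigma (history (x 0%N) xis t) (y t) (xis t))
  (T : nat) (c D : R) (c0 : 0 < c) (D0 : 0 < D)
  (bregmanD : forall x z, X x -> X z -> bregman psi gpsi z x <= D) :
  ((forall t, (t <= T)%N -> gam t = c / Num.sqrt T.+1%:R) ->
    (\int[P]_w dual_gap X F
        (T.+1%:R^-1 *: \sum_(0 <= t < T.+1) y t.+1 w)%R
     <= ((2 * D + c ^+ 2 * Dhat nu L M alpha D sigma)
         / (c * Num.sqrt T.+1%:R))%R%:E)%E)
  /\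
  ((forall t, (t <= T)%N -> gam t = c / Num.sqrt t.+1%:R) ->
    (\int[P]_w dual_gap X F
        ((\sum_(uphalf T <= t < T.+1) gam t)^-1
           *: \sum_(uphalf T <= t < T.+1) gam t *: y t.+1 w)%R
     <= ((4 * D + 2 * Dhat nu L M alpha D sigma * c ^+ 2 * ln 4)
         / (c * Num.sqrt T.+1%:R))%R%:E)%E).
Proof.
pose K := variation_bound nu L M alpha D.
have F_K u v : X u -> X v -> dual_norm nrm (F u - F v) <= K.
  exact: (growth_variation_bound nrm_norm alpha0 psi_sc bregmanD nu0 L0 Fgrowth).
have xis_meas t : measurable_fun setT (xis t) by exact: measurable_funPT.
have bound s (sT : (s <= T)%N) := weighted_gap_bound nrm_norm Xclosed Xconvex
  Xbounded psiC1 alpha0 psi_sc Fmono F_K Fhat_meas gam0 xis_meas x0_rv xy_popov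
  sampling_y bregmanD sT.
set Q := (2 * K ^+ 2 + 9 * sigma ^+ 2) / (2 * alpha) in bound.
have QD : Q <= Dhat nu L M alpha D sigma by exact: Dhat_ge.
have Q0 : 0 <= Q.
  apply: divr_ge0; first by rewrite addr_ge0// mulr_ge0// sqr_ge0.
  by rewrite mulr_ge0// ltW.
have q0 : 0 < c * Num.sqrt T.+1%:R by rewrite mulr_gt0// sqrtr_gt0.
split=> hg.
  have [sum1 sum2] := constant_step_sums hg.
  have := bound 0%N isT; rewrite sum1 -mulr_suml sum2.
  (* With equal weights the weighted average becomes the plain average. *)
  under eq_integral => w _.
    under eq_big_nat => t /andP[_ tT] do rewrite hg//.
    rewrite -scaler_sumr scalerA.
    over.
  rewrite (_ : (c * _)^-1 * _ = T.+1%:R^-1).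
    move=> /le_trans; apply; rewrite lee_fin mulrC ler_wpM2r ?invr_ge0 ?(ltW q0)//.
    by rewrite lerD2l ler_wpM2l ?sqr_ge0.
  rewrite -[in RHS](sqr_sqrtr (ler0n R T.+1)).
  by field; rewrite gt_eqF ?c0// gt_eqF// sqrtr_gt0.
have [sum1 sum2] := decreasing_step_sums c0 hg.
have sT : (uphalf T <= T)%N by lia.
apply: le_trans (bound _ sT) _; rewrite lee_fin -mulr_suml.
set G := \sum_(_ <= _ < _) gam _ in sum1 *.
set A := \sum_(_ <= _ < _) _ in sum2 *.
have G0 : 0 < G by rewrite -(pmulr_rgt0 _ (ltr0n R 2)) (lt_le_trans q0).
have A0 : 0 <= A by apply: sumr_ge0 => t _; exact: sqr_ge0.
have AQ : A * Q <= c ^+ 2 * ln 4 * Dhat nu L M alpha D sigma.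
  by apply: ler_pM.
rewrite mulrC ler_pdivrMr// mulrAC ler_pdivlMr//.
(* Replacing c sqrt (T + 1) by the larger 2 G accounts for the doubled constants 4 D and 2 Dhat. *)
apply: (@le_trans _ _ ((2 * D + A * Q) * (2 * G))).
  by rewrite ler_wpM2l// addr_ge0//; apply: mulr_ge0 => //; exact: ltW.
by rewrite mulrA ler_wpM2r ?(ltW G0)//; lra.
Qed.
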